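(* In the setting described in the context, let $F\subseteq\mathcal X$ be the set of all $x\in\mathcal X$ for which there exist $z\in\{0,1\}^N$, $t\ge 0$, $r\in\mathbb R^N_{\ge 0}$ satisfying (1) $\epsilon t\ge \theta\|b-A^\top x\|_*+\frac1N\sum_{i\in[N]}r^i$, (2) $M^i(1-z^i)\ge t-r^i$ for all $i\in[N]$, (3) $(-A\xi_p^i-a_p)^\top x+(b^\top\xi_p^i+d_p)+M^iz^i\ge t-r^i$ for all $i\in[N]$, $p\in[P]$. Let $F^+\subseteq\mathcal X$ be the set of all $x\in\mathcal X$ for which there exist $z\in\{0,1\}^N$, $t\ge 0$, $r\in\mathbb R^N_{\ge 0}$ satisfying (1), (2), (3) and in addition (4) $\sum_{i\in[N]}z^i\le\lfloor\epsilon N\rfloor$, (5) $(-A\xi_p^i-a_p)^\top x+(b^\top\xi_p^i+d_p)+M^iz^i\ge 0$ for all $i\in[N]$, $p\in[P]$. Then $$\begin{aligned}F^+&=F\setminus\{x\in\mathcal X: b=A^\top x,\ d_p<a_p^\top x\text{ for some }p\in[P]\}\\&=\mathcal X_{\mathrm{DR}}(\mathcal S^o)\cup\{x\in\mathcal X: b=A^\top x,\ d_p=a_p^\top x\text{ for some }p\in[P]\}\\&=\mathcal X_{\mathrm{DR}}(\mathcal S^c).\end{aligned}$$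
   Context: Notation: $[n]=\{1,\dots,n\}$. Data: $\mathcal X\subseteq\mathbb R^L$; positive integers $N,P,K_0$, $K=PK_0$; $A\in\mathbb R^{L\times K_0}$, $b\in\mathbb R^{K_0}$, $a_p\in\mathbb R^L$, $d_p\in\mathbb R$ for $p\in[P]$; risk tolerance $\epsilon\in(0,1)$; radius $\theta>0$. Vectors $\xi\in\mathbb R^K$ are written in blocks $\xi=(\xi_1,\dots,\xi_P)$ with $\xi_p\in\mathbb R^{K_0}$. Samples $\xi^1,\dots,\xi^N\in\mathbb R^K$ are fixed, with blocks $\xi^i_p$, and $\mathbb P_N$ is the empirical distribution (mass $1/N$ at each $\xi^i$). $\|\cdot\|$ is a norm on $\mathbb R^K$. For $v\in\mathbb R^{K_0}$, $\|v\|_*$ denotes the dual norm of the vector in $\mathbb R^K$ having $v$ in block $p$ and zeros elsewhere; this is assumed not to depend on $p$ (as for $\ell_q$-norms). Wasserstein distance: $d_W(\mathbb P,\mathbb P')=\inf_\Pi\{\mathbb E_{(\xi,\xi')\sim\Pi}\|\xi-\xi'\|:\Pi\text{ has marginals }\mathbb P,\mathbb P'\}$, and $\mathcal F_N(\theta)=\{\mathbb P: d_W(\mathbb P_N,\mathbb P)\le\theta\}$, a set of probability distributions on $\mathbb R^K$. Safety sets, for $x\in\mathcal X$: $\mathcal S^o(x)=\{\xi\in\mathbb R^K:(b-A^\top x)^\top\xi_p+d_p-a_p^\top x>0,\ p\in[P]\}$ (open), $\mathcal S^c(x)=\{\xi\in\mathbb R^K:(b-A^\top x)^\top\xi_p+d_p-a_p^\top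 x\ge0,\ p\in[P]\}$ (closed). For $\mathcal S\in\{\mathcal S^o,\mathcal S^c\}$, $\mathcal X_{\mathrm{DR}}(\mathcal S)=\{x\in\mathcal X:\sup_{\mathbb P\in\mathcal F_N(\theta)}\mathbb P[\xi\notin\mathcal S(x)]\le\epsilon\}$. The constants $M^1,\dots,M^N>0$ are sufficiently large, meaning $M^i\ge|(-A\xi_p^i-a_p)^\top x+(b^\top\xi_p^i+d_p)|$ for all $x\in\mathcal X$, $p\in[P]$.
   Formalization: In the second equality, the added set {b=A^T x, d_p=a_p^T x for some p} is replaced by that set minus {b=A^T x, d_p<a_p^T x for some p}; as printed the equality fails for P≥2 when both sets meet, and agrees with it otherwise. *)

(* Defs.v *)
From HB Require Import structures.
From mathcomp Require Export all_boot all_order all_algebra.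
From mathcomp Require Export all_classical all_reals all_analysis.
Export Order.TTheory GRing.Theory Num.Theory numFieldNormedType.Exports.

Set Implicit Arguments.
Unset Strict Implicit.
Unset Printing Implicit Defensive.

Local Open Scope classical_set_scope.
Local Open Scope ring_scope.

Section vectors.
Context {R : realType}.

Definition dot n (u v : 'cV[R]_n) : R := \sum_i u i 0 * v i 0.

Definition is_norm n (nrm : 'cV[R]_n -> R) : Prop :=
  [/\ forall u, nrm u = 0 -> u = 0,
      forall (c : R) u, nrm (c *: u) = `|c| * nrm u
    & forall u v, nrm (u + v) <= nrm u + nrm v].

(* The set below is nonempty and, when [nrm] is a norm, bounded, so that the
   real-valued [sup] is the actual supremum. *)
Definition dual_norm n (nrm : 'cV[R]_n -> R) (w : 'cV[R]_n) : R :=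
  sup [set dot w u | u in [set u | nrm u <= 1]].

(* [mxvec_index p k : 'I_(P * K0)] is the position of coordinate [k] of
   block [p]. *)
Definition block P K0 (xi : 'cV[R]_(P * K0)) (p : 'I_P) : 'cV[R]_K0 :=
  \col_k xi (mxvec_index p k) 0.

Definition place P K0 (p : 'I_P) (v : 'cV[R]_K0) : 'cV[R]_(P * K0) :=
  \sum_k v k 0 *: delta_mx (mxvec_index p k) 0.

End vectors.

(* The Borel sigma-algebra; the product of two such types carries the product
   sigma-algebra, which is again the Borel one by second countability. *)
Definition borelCV (R : realType) (n : nat) :=
  g_sigma_algebraType (@open 'cV[R]_n).
HB.instance Definition _ (R : realType) n := Measurable.on (borelCV R n).

Section distributions.
Context {R : realType} {n : nat}.
Notation T := (borelCV R n).

Definition empirical N (xi : 'I_N -> 'cV[R]_n) (B : set T) : \bar R :=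
  (N%:R^-1%:E * \sum_(i < N) \d_(xi i : T) B)%E.

Section empirical_measure.
Variables (N : nat) (xi : 'I_N -> 'cV[R]_n).

Let empirical0 : empirical xi set0 = 0%E.
Proof. by rewrite /empirical big1 ?mule0 // => i _; rewrite measure0. Qed.

Let empirical_ge0 B : (0 <= empirical xi B)%E.
Proof.
by apply: mule_ge0; [rewrite lee_fin invr_ge0|apply: sume_ge0 => i _].
Qed.

Let empirical_sigma_additive : semi_sigma_additive (empirical xi).
Proof.
move=> F mF tF mUF; rewrite [X in X @ _ --> _](_ : _ =
  (fun m => (N%:R^-1%:E * \sum_(i < N) \sum_(0 <= k < m) \d_(xi i : T) (F k))%E)).
  apply: cvgeZl => //; apply: cvg_nnesum => i _.
    by apply: nearW => m; apply: sume_ge0.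
  exact: measure_semi_sigma_additive.
apply/funext => m; rewrite exchange_big /= ge0_sume_distrr // => k _.
exact: sume_ge0.
Qed.

HB.instance Definition _ := isMeasure.Build _ T R (empirical xi)
  empirical0 empirical_ge0 empirical_sigma_additive.

End empirical_measure.

Definition coupling (mu nu : {measure set T -> \bar R})
    (Pi : probability (T * T)%type R) : Prop :=
  forall B : set T, measurable B ->
    pushforward Pi fst B = mu B /\ pushforward Pi snd B = nu B.

Definition wasserstein (nrm : 'cV[R]_n -> R)
    (mu nu : {measure set T -> \bar R}) : \bar R :=
  ereal_inf [set (\int[Pi]_w (nrm ((w.1 : 'cV[R]_n) - w.2))%:E)%E
            | Pi in coupling mu nu].

Definition ambiguity (nrm : 'cV[R]_n -> R) N (xi : 'I_N -> 'cV[R]_n)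
    (theta : R) : set (probability T R) :=
  [set Q | (wasserstein nrm (empirical xi) Q <= theta%:E)%E].

Definition X_DR L (nrm : 'cV[R]_n -> R) N (xi : 'I_N -> 'cV[R]_n)
    (theta eps : R) (X : set 'cV[R]_L) (S : 'cV[R]_L -> set 'cV[R]_n) :
    set 'cV[R]_L :=
  [set x | X x /\
    (ereal_sup [set Q (~` S x) | Q in ambiguity nrm xi theta] <= eps%:E)%E].

End distributions.

Section model.
Context {R : realType} {L P K0 : nat}.
Variables (A : 'M[R]_(L, K0)) (b : 'cV[R]_K0).
Variables (a : 'I_P -> 'cV[R]_L) (d : 'I_P -> R).

Definition S_open (x : 'cV[R]_L) : set 'cV[R]_(P * K0) :=
  [set xi | forall p,
    0 < dot (b - A^T *m x) (block xi p) + d p - dot (a p) x].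

Definition S_closed (x : 'cV[R]_L) : set 'cV[R]_(P * K0) :=
  [set xi | forall p,
    0 <= dot (b - A^T *m x) (block xi p) + d p - dot (a p) x].

Definition slack (x : 'cV[R]_L) (xi : 'cV[R]_(P * K0)) (p : 'I_P) : R :=
  dot (- (A *m block xi p) - a p) x + (dot b (block xi p) + d p).

Variables (X : set 'cV[R]_L) (dnorm : 'cV[R]_K0 -> R).
Variables (N : nat) (xi : 'I_N -> 'cV[R]_(P * K0)) (M : 'I_N -> R).
Variables (theta eps : R).

Definition mip_base (x : 'cV[R]_L) (z : 'I_N -> bool) (t : R) (r : 'I_N -> R) :
    Prop :=
  [/\ 0 <= t /\ (forall i, 0 <= r i),
      theta * dnorm (b - A^T *m x) + N%:R^-1 * \sum_i r i <= eps * t,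
      forall i, t - r i <= M i * (1 - (z i)%:R)
    & forall i p, t - r i <= slack x (xi i) p + M i * (z i)%:R].

Definition mip_cuts (x : 'cV[R]_L) (z : 'I_N -> bool) : Prop :=
  Posz (\sum_i z i)%N <= Num.floor (eps * N%:R) /\
  forall i p, 0 <= slack x (xi i) p + M i * (z i)%:R.

Definition F_base : set 'cV[R]_L :=
  [set x | X x /\ exists z t r, mip_base x z t r].

Definition F_plus : set 'cV[R]_L :=
  [set x | X x /\ exists z t r, mip_base x z t r /\ mip_cuts x z].

(* For [P >= 2] the next two sets may overlap: different [p] may witness the
   strict inequality and the equality. *)
Definition degenerate_lt : set 'cV[R]_L :=
  [set x | [/\ X x, b = A^T *m x & exists p, d p < dot (a p) x]].

Definition degenerate_eq : set 'cV[R]_L :=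
  [set x | [/\ X x, b = A^T *m x & exists p, d p = dot (a p) x]].

End model.

(* Main.v *)
From HB Require Import structures.
Require Import Defs.
From mathcomp Require Import measurable_realfun lra ring.

Set Implicit Arguments.
Unset Strict Implicit.
Unset Printing Implicit Defensive.

Local Open Scope classical_set_scope.
Local Open Scope ring_scope.

(** Fix a decision [x] and put [w = b - A^T x].

    If [w] is not zero, its dual norm [nu] is positive and the distance of a
    point [u] to the unsafe set is [delta u = max 0 (min_slack u) / nu]: the
    slack of constraint [p] is an affine function of [u] whose linear part has
    dual norm [nu] ([unsafe_dist_le], [unsafe_dist_approx]). It does not matter
    whether the safety set is open or closed. Then all four sets say that some
    [t >= 0] satisfies
      [theta + N^-1 * \sum_i max 0 (t - delta (xi i)) <= eps * t],
    the dual of the problem of moving as much mass as possible into the unsafe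
    set at transport cost at most [theta].
    - Such a [t] bounds the risk of every law in the ball, by integrating a
      pointwise inequality against a coupling ([weak_duality]).
    - Conversely the worst case of discrete laws that move a fraction of each
      sample is a fractional knapsack problem, which has no duality gap
      ([knapsack_duality], [dual_of_worst_case]).
    - Eliminating the binary variables from the mixed-integer program leaves
      this inequality up to scaling by [nu] ([F_base_dual]), and a solution [t]
      of it extends to a solution of the program that satisfies the cuts
      ([dual_F_plus]).

    If [w = 0], slacks do not depend on the sample and no transport is needed:
    the unsafe set is empty or the whole space, and the sets are compared by
    inspection of the signs of [d p - dot (a p) x]. The base program accepts
    every such [x], through [t = 0] and all [z i] equal to 1, which is why the
    infeasible ones have to be removed from it; a zero slack is where the open
    and the closed safety sets differ. *)

(** * Inner products and blocks *)

Section inner_product.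
Context {R : realType}.

Lemma dotE n (u v : 'cV[R]_n) : dot u v = (u^T *m v) 0 0.
Proof. by rewrite mxE; apply: eq_bigr => i _; rewrite mxE. Qed.

Lemma dotDl n (u v w : 'cV[R]_n) : dot (u + v) w = dot u w + dot v w.
Proof. by rewrite !dotE linearD mulmxDl mxE. Qed.

Lemma dotNl n (u w : 'cV[R]_n) : dot (- u) w = - dot u w.
Proof. by rewrite !dotE linearN mulNmx mxE. Qed.

Lemma dotZl n c (u w : 'cV[R]_n) : dot (c *: u) w = c * dot u w.
Proof. by rewrite !dotE linearZ -scalemxAl mxE. Qed.

Lemma dotC n (u v : 'cV[R]_n) : dot u v = dot v u.
Proof. by apply: eq_bigr => i _; rewrite mulrC. Qed.

Lemma dotBr n (u v w : 'cV[R]_n) : dot u (v - w) = dot u v - dot u w.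
Proof. by rewrite ![dot u _]dotC dotDl dotNl. Qed.

Lemma dotZr n c (u w : 'cV[R]_n) : dot u (c *: w) = c * dot u w.
Proof. by rewrite ![dot u _]dotC dotZl. Qed.

Lemma dot0l n (u : 'cV[R]_n) : dot 0 u = 0.
Proof. by rewrite dotE trmx0 mul0mx mxE. Qed.

Lemma dot_trmx m n (A : 'M[R]_(m, n)) u x :
  dot (A *m u) x = dot (A^T *m x) u.
Proof. by rewrite [RHS]dotC !dotE trmx_mul mulmxA. Qed.

Lemma dot_gt0 n (u : 'cV[R]_n) : u != 0 -> 0 < dot u u.
Proof.
move=> u0; rewrite lt_neqAle sumr_ge0 ?andbT; last first.
  by move=> i _; rewrite -expr2 sqr_ge0.
apply: contra u0; rewrite eq_sym psumr_eq0; last first.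
  by move=> i _; rewrite -expr2 sqr_ge0.
move=> /allP uu; apply/eqP/colP => i; rewrite mxE.
have /implyP/(_ isT) := uu i (mem_index_enum _).
by rewrite mulf_eq0 orbb => /eqP.
Qed.

(** [place p] and [block _ p] are adjoint; this turns a functional of one block
    into a functional of the whole vector, to which the dual norm applies. *)
Lemma dot_place P K0 (p : 'I_P) (v : 'cV[R]_K0) (u : 'cV[R]_(P * K0)) :
  dot (place p v) u = dot v (block u p).
Proof.
rewrite dotE /place linear_sum /= mulmx_suml summxE; apply: eq_bigr => k _.
rewrite linearZ /= -scalemxAl mxE trmx_delta -rowE !mxE.
by congr (_ * _).
Qed.

Lemma blockK P K0 (p : 'I_P) (v : 'cV[R]_K0) : block (place p v) p = v.
Proof.
apply/colP => k; rewrite mxE /place summxE (bigD1 k) //= big1 ?addr0.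
  by rewrite !mxE !eqxx mulr1.
move=> j jk; rewrite !mxE eqxx andbT; case: eqP => [|]; last by rewrite mulr0.
by move=> /cast_ord_inj/enum_rank_inj [] /eqP; rewrite eq_sym (negbTE jk).
Qed.

Lemma place_neq0 P K0 (p : 'I_P) (v : 'cV[R]_K0) : v != 0 -> place p v != 0.
Proof.
apply: contra => /eqP pv0; rewrite -(blockK p v) pv0.
by apply/eqP/colP => k; rewrite !mxE.
Qed.

End inner_product.

(** * Equivalence of norms and the dual norm *)

Section dual_norm.
Context {R : realType} {n : nat}.
Variable nrm : 'cV[R]_n -> R.
Hypothesis hnrm : is_norm nrm.
Implicit Types u w : 'cV[R]_n.

Lemma nrm0 : nrm 0 = 0.
Proof. by case: hnrm => _ hZ _; rewrite -(scale0r 0) hZ normr0 mul0r. Qed.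

Lemma nrmN u : nrm (- u) = nrm u.
Proof. by case: hnrm => _ hZ _; rewrite -scaleN1r hZ normrN1 mul1r. Qed.

Lemma nrm_ge0 u : 0 <= nrm u.
Proof.
case: hnrm => _ _ hD; have := hD u (- u).
by rewrite subrr nrm0 nrmN -mulr2n pmulrn_lge0.
Qed.

Lemma nrm_gt0 u : u != 0 -> 0 < nrm u.
Proof.
case: hnrm => h0 _ _ u0; rewrite lt_neqAle nrm_ge0 andbT eq_sym.
by apply: contra u0 => /eqP/h0 ->.
Qed.

Lemma nrm_sum (I : Type) (s : seq I) (F : I -> 'cV[R]_n) :
  nrm (\sum_(i <- s) F i) <= \sum_(i <- s) nrm (F i).
Proof.
case: hnrm => _ _ hD; elim: s => [|i s ih]; first by rewrite !big_nil nrm0.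
by rewrite !big_cons (le_trans (hD _ _))// lerD2l.
Qed.

Lemma ler_mx_coord p q (v : 'M[R]_(p, q)) i j : `|v i j| <= `|v|.
Proof.
rewrite [leRHS]/Num.norm /= mx_normrE.
exact: (le_bigmax _ (fun ij : 'I_p * 'I_q => `|v ij.1 ij.2|) (i, j)).
Qed.

Lemma normr_trmx p q (v : 'M[R]_(p, q)) : `|v^T| = `|v|.
Proof.
have h p' q' (x : 'M[R]_(p', q')) : `|x^T| <= `|x|.
  rewrite [leLHS]/Num.norm /= mx_normrE; apply/bigmax_leP; split=> // ij _.
  by rewrite mxE ler_mx_coord.
by apply/eqP; rewrite eq_le h /= -{1}(trmxK v) h.
Qed.

Lemma colE (u : 'cV[R]_n) : u = \sum_i u i 0 *: delta_mx i 0.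
Proof.
apply/colP => i; rewrite summxE (bigD1 i)//= big1 ?addr0.
  by rewrite !mxE !eqxx mulr1.
by move=> j ji; rewrite !mxE eq_sym (negbTE ji) mulr0.
Qed.

Lemma nrm_le_normr : exists2 C, 0 < C & forall u, nrm u <= C * `|u|.
Proof.
exists (1 + \sum_i nrm (delta_mx i 0)).
  by rewrite ltr_pwDl// sumr_ge0// => i _; exact: nrm_ge0.
move=> u; rewrite mulrDl mul1r ler_wpDl// {1}(colE u).
rewrite (le_trans (nrm_sum _ _))// mulr_suml; apply: ler_sum => i _.
case: hnrm => _ hZ _; rewrite hZ mulrC ler_wpM2l ?nrm_ge0 //.
exact: ler_mx_coord.
Qed.

Lemma lipschitz_mx_continuous p q (f : 'M[R]_(p, q) -> R) C : 0 < C ->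
  (forall x y, f x - f y <= C * `|x - y|) -> continuous f.
Proof.
move=> C0 h u s /= /(nbhs_ballP (f u)) [e e0 es].
apply/(nbhs_ballP u); exists (e / C); first exact: divr_gt0.
move=> v; rewrite mx_norm_ball /ball_ /= ltr_pdivlMr// mulrC => uv.
apply: es; rewrite /ball/=; apply: le_lt_trans uv.
by rewrite ler_norml h andbT lerNl opprB distrC h.
Qed.

(** The hard half of the equivalence of norms: [nrm] is Lipschitz for the max
    norm, so it attains a positive minimum on the compact unit sphere of the
    latter. Compactness of bounded closed sets is stated for row vectors, hence
    the transpositions. *)
Lemma normr_le_nrm : exists2 C, 0 < C & forall u, `|u| <= C * nrm u.
Proof.
pose f (v : 'rV[R]_n) := nrm v^T.
pose S := [set v : 'rV[R]_n | `|v| = 1].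
have cf : continuous f.
  have [C C0 hC] := nrm_le_normr.
  apply: (lipschitz_mx_continuous C0) => v w.
  rewrite /f lerBlDr -normr_trmx linearB /=.
  have [_ _ hD] := hnrm.
  by rewrite (le_trans _ (lerD (hC _) (lexx _)))// -{1}(subrK w^T v^T).
(* The sphere is empty only in dimension 0, where every vector is 0. *)
have [S0|S0] := eqVneq S set0.
  exists 1 => // u; rewrite mul1r.
  have [->|u0] := eqVneq u 0; first by rewrite normr0 nrm_ge0.
  have /= : S (`|u|^-1 *: u^T).
    by rewrite /S /= normrZ normfV normr_id normr_trmx mulVf// normr_eq0.
  by rewrite S0.
have cptS : compact S.
  apply: bounded_closed_compact.
    by exists 1; split => // M M1 v /= ->; exact: ltW.
  apply: (@preimage_closed 'rV[R]_n R Num.norm [set 1]); last exact: closed_eq.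
  move=> v _; apply: (@lipschitz_mx_continuous _ _ _ 1) => // a b.
  by rewrite mul1r lerB_dist.
have /set0P Sn0 := S0.
have [c] := compact_EVT_min Sn0 cptS (continuous_subspaceT cf).
rewrite inE => cS cmin.
have fc : 0 < f c.
  apply: nrm_gt0; apply: contra_eq_neq cS => c0.
  by rewrite -(trmxK c) c0 trmx0 normr0 eq_sym oner_eq0.
exists (f c)^-1; first by rewrite invr_gt0.
move=> u; have [->|u0] := eqVneq u 0; first by rewrite normr0 nrm0 mulr0.
rewrite mulrC ler_pdivlMr// mulrC.
have := cmin (`|u|^-1 *: u^T).
rewrite inE /S /= normrZ normfV normr_id normr_trmx mulVf ?normr_eq0// => /(_ erefl).
rewrite {2}/f linearZ /= trmxK; case: hnrm => _ -> _.
by rewrite normfV normr_id mulrC ler_pdivlMr ?normr_gt0.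
Qed.

Lemma normr_dot_le w u : `|dot w u| <= (\sum_i `|w i 0|) * `|u|.
Proof.
rewrite (le_trans (ler_norm_sum _ _ _))// mulr_suml; apply: ler_sum => i _.
by rewrite normrM ler_wpM2l// ler_mx_coord.
Qed.

(** Without boundedness, [sup] would take its default value and [dual_norm]
    would not be the dual norm. *)
Lemma dual_norm_has_sup w :
  has_sup [set dot w u | u in [set u | nrm u <= 1]].
Proof.
split; first by exists (dot w 0), 0 => //=; rewrite nrm0.
have [C C0 hC] := normr_le_nrm.
exists ((\sum_i `|w i 0|) * C) => _ [u /= u1 <-].
rewrite (le_trans (ler_norm _))// (le_trans (normr_dot_le _ _))//.
rewrite ler_wpM2l ?sumr_ge0// (le_trans (hC _))//.
by rewrite -[leRHS]mulr1 ler_pM2l.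
Qed.

(** Generalized Cauchy-Schwarz inequality, by homogeneity from the unit ball. *)
Lemma dot_le_dual_norm w u : dot w u <= dual_norm nrm w * nrm u.
Proof.
have [->|u0] := eqVneq u 0; first by rewrite nrm0 mulr0 dotC dot0l.
have nu := nrm_gt0 u0.
rewrite -ler_pdivrMr// mulrC -dotZr.
apply: ub_le_sup; first by case: (dual_norm_has_sup w).
exists ((nrm u)^-1 *: u) => //=; case: hnrm => _ -> _.
by rewrite ger0_norm ?invr_ge0 ?nrm_ge0// mulVf ?gt_eqF.
Qed.

Lemma dual_norm_adherent w c : c < dual_norm nrm w ->
  exists2 u, nrm u <= 1 & c < dot w u.
Proof.
rewrite -subr_gt0 => c0.
have [_ [u u1 <-]] := sup_adherent c0 (dual_norm_has_sup w).
by rewrite opprB addrC subrK; exists u.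
Qed.

Lemma dual_norm_gt0 w : w != 0 -> 0 < dual_norm nrm w.
Proof.
move=> w0; have := lt_le_trans (dot_gt0 w0) (dot_le_dual_norm w w).
by rewrite pmulr_lgt0// nrm_gt0.
Qed.

Lemma dual_norm0 : dual_norm nrm 0 = 0.
Proof.
rewrite /dual_norm (_ : [set _ | _ in _] = [set 0]) ?sup1//.
apply/seteqP; split=> [_ [u _ <-]|_ ->]; first by rewrite /= dot0l.
by exists 0; rewrite /= ?nrm0 ?dot0l.
Qed.

End dual_norm.

(** * Duality for the fractional knapsack problem *)

Section quantile.
Context {R : realType} {N : nat}.
Variables (m : 'I_N -> R) (q : R).
Hypotheses (q_ge0 : 0 <= q) (q_ltN : q < N%:R).

(** The smallest value [m i0] whose lower level set has more than [q] elements: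
    by minimality the strict lower level set, which is the level set of the
    next smaller value if it is nonempty, has at most [q]. *)
Lemma quantile_exists : exists2 i0,
  #|[pred i | m i < m i0]|%:R <= q & q < #|[pred i | m i <= m i0]|%:R.
Proof.
have N0 : (0 < N)%N by rewrite -(ltr_nat R) (le_lt_trans q_ge0).
pose i1 := Ordinal N0.
pose big i := q < #|[pred j | m j <= m i]|%:R.
have [imax _ hmax] := arg_maxP m (erefl : xpredT i1).
have bigmax : big imax.
  rewrite /big (_ : #|_| = N)// -[RHS]card_ord; apply: eq_card => j.
  by rewrite !inE; apply: hmax.
have [i0 i0big hmin] := arg_minP m bigmax.
exists i0 => //.
have [k /= ki0|none] := pickP [pred i | m i < m i0]; last first.
  by rewrite (_ : #|_| = 0%N)//; apply: eq_card0; exact: none.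
have [k' k'i0 k'max] := arg_maxP m (ki0 : [pred i | m i < m i0] k).
rewrite (_ : #|_| = #|[pred j | m j <= m k']|).
  by rewrite leNgt; apply/negP => /hmin; rewrite leNgt (k'i0 : is_true (m k' < m i0)).
apply: eq_card => j; rewrite !inE; apply/idP/idP => [|jk]; first exact: k'max.
exact: le_lt_trans k'i0.
Qed.

(** Linear programming duality for the fractional knapsack problem of choosing
    weights in [0, 1] of total [q] at least cost [\sum_i al i * m i]. The dual
    problem maximizes [q * t - \sum_i max 0 (t - m i)]. The quantile [t] of [m]
    at level [q] and the greedy weights (1 below [t], a constant fraction at
    [t], 0 above) have the same value, hence are optimal. Either this value is
    at least [kappa], or the gap leaves room for a little more weight. *)
Lemma knapsack_duality (kappa : R) :
  (forall i, 0 <= m i) ->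
  (exists2 t, 0 <= t & kappa + \sum_i Num.max 0 (t - m i) <= q * t) \/
  (exists al : 'I_N -> R, [/\ forall i, 0 <= al i <= 1,
     \sum_i al i * m i < kappa & q < \sum_i al i]).
Proof.
move=> m0; have [i0 qlt qle] := quantile_exists.
set t := m i0 in qlt qle.
set c := #|_| in qlt; set c' := #|_| in qle.
pose e := #|[pred i | m i == t]|.
have cE : (c + e)%N = c'.
  rewrite /c /c' -cardUI [X in (_ + X)%N]eq_card0 ?addn0; last first.
    by move=> i; rewrite !inE; case: ltgtP.
  by apply: eq_card => i; rewrite !inE orbC -le_eqVlt.
pose al lam i := if m i < t then 1 else if m i == t then lam else 0 : R.
have alE lam i : al lam i = (m i < t)%R%:R + lam * (m i == t)%:R.
  by rewrite /al; case: ltgtP; rewrite ?mulr0 ?mulr1 ?addr0 ?add0r.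
have cardR (P : pred 'I_N) : \sum_i (P i)%:R = #|P|%:R :> R.
  by rewrite -natr_sum -sum1_card [in RHS]big_mkcond.
pose S := \sum_i (m i < t)%R%:R * m i.
have sal lam : \sum_i al lam i = c%:R + lam * e%:R.
  by under eq_bigr do rewrite alE; rewrite big_split/= -mulr_sumr !cardR.
have salm lam : \sum_i al lam i * m i = S + lam * e%:R * t.
  under eq_bigr do rewrite alE mulrDl.
  rewrite big_split/= /S -cardR mulr_sumr mulr_suml; congr (_ + _).
  apply: eq_bigr => i _.
  by rewrite /=; case: eqP => [->//|_]; rewrite mulr0 !mul0r.
have [h|h] := leP (kappa + \sum_i Num.max 0 (t - m i)) (q * t).
  by left; exists t; first exact: m0.
right.
have sE : \sum_i Num.max 0 (t - m i) = c%:R * t - S.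
  rewrite /c -cardR mulr_suml -sumrB; apply: eq_bigr => i _.
  rewrite -mulrBr /=; case: (ltP (m i) t) => mt; rewrite ?mul1r ?mul0r.
    by rewrite max_r// subr_ge0 ltW.
  by rewrite max_l// subr_le0.
have {cE} cE : c%:R + e%:R = c'%:R :> R by rewrite -natrD cE.
have e0 : 0 < e%:R :> R by lra.
have t0 : 0 <= t := m0 i0.
(* The fraction lam0 at t makes the total weight exactly q; the gap g in cost
   leaves room to increase it by tau. *)
pose lam0 := (q - c%:R) / e%:R.
pose g := kappa - (S + (q - c%:R) * t).
have g0 : 0 < g by rewrite /g; lra.
have lamE : lam0 * e%:R = q - c%:R by rewrite /lam0 divfK ?gt_eqF.
have lam_ge0 : 0 <= lam0 by apply: divr_ge0; [rewrite subr_ge0|exact: ltW].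
have lam_lt1 : lam0 < 1 by rewrite ltr_pdivrMr// mul1r; lra.
have et1 : 0 < e%:R * t + 1 by rewrite ltr_wpDl// mulr_ge0.
pose tau := Num.min (1 - lam0) (g / (e%:R * t + 1)).
have tau0 : 0 < tau by rewrite lt_min subr_gt0 lam_lt1 divr_gt0.
have tau1 : tau <= 1 - lam0 by rewrite ge_min lexx.
have taug : tau * (e%:R * t + 1) <= g.
  by rewrite -ler_pdivlMr// ge_min lexx orbT.
exists (al (lam0 + tau)); split.
- by move=> i; rewrite /al; case: ifP => _; [lra|case: ifP => _; lra].
- by rewrite salm mulrDl lamE; move: taug tau0; rewrite /g; lra.
- by rewrite sal mulrDl lamE; have := mulr_gt0 tau0 e0; lra.
Qed.

End quantile.

(** * Integration against finitely supported laws *)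

Section integral_without_measurability.
Local Open Scope ereal_scope.
Context d (T : measurableType d) (R : realType).
Import HBNNSimple.

(** The integral of a nonnegative function is a supremum over the simple
    functions below it, hence monotone even when [f] and [g] are not
    measurable. The transport cost [nrm (u - v)] can therefore be integrated
    against a coupling without proving that it is measurable for the product
    sigma-algebra. *)
Lemma ge0_le_integralT (mu : {measure set T -> \bar R}) (f g : T -> \bar R) :
  (forall x, 0 <= f x) -> (forall x, f x <= g x) ->
  \int[mu]_x f x <= \int[mu]_x g x.
Proof.
move=> f0 fg.
have g0 x : 0 <= g x by exact: le_trans (fg x).
rewrite !ge0_integralTE//; apply: le_ereal_sup => _ [h hf <-].
by exists h => // x; exact: le_trans (hf x) (fg x).
Qed.

(** For the same reason measurability of [f] is not assumed: a simple function
    below [f] satisfies the bound, with equality for its own values at the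
    atoms. *)
Lemma le_integral_discrete (mu : {measure set T -> \bar R}) (I : finType)
    (w : I -> R) (x : I -> T) (f : T -> \bar R) :
  (forall i, (0 <= w i)%R) -> (forall y, 0 <= f y) ->
  (forall B, measurable B -> mu B = \sum_i (w i)%:E * \d_(x i) B) ->
  \int[mu]_y f y <= \sum_i (w i)%:E * f (x i).
Proof.
move=> w0 f0 muE; rewrite ge0_integralTE//.
apply: ge_ereal_sup => _ [h hf <-].
apply: (@le_trans _ _ (\sum_i (w i)%:E * (h (x i))%:E)); last first.
  by apply: lee_sum => i _; rewrite lee_wpmul2l ?lee_fin.
rewrite sintegralE.
under eq_fsbigr => r _.
  rewrite muE// ge0_sume_distrr; last first.
    by move=> i _; rewrite mule_ge0// lee_fin.
  over.
rewrite fsbig_finite//= exchange_big/=; apply: lee_sum => i _.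
under eq_bigr do rewrite muleCA.
rewrite -ge0_sume_distrr; last first.
  by move=> r _; exact: (nnsfun_mulemu_ge0 (dirac (x i) : {measure set T -> \bar R}) h r).
rewrite lee_wpmul2l ?lee_fin//.
rewrite -fsbig_finite//= (fsbigD1 (h (x i)))//=; last by exists (x i).
rewrite diracE mem_set// mule1 fsbig1 ?adde0// => r /= [_ rh].
by rewrite diracE memNset ?mule0//= => /esym.
Qed.

End integral_without_measurability.

Section discrete_law.
Local Open Scope ereal_scope.
Context d (T : measurableType d) (R : realType) (I : finType).
Variables (w : I -> R) (x : I -> T).
Hypotheses (w0 : forall i, (0 <= w i)%R) (w1 : (\sum_i w i = 1)%R).

(** The proofs [w0] and [w1] are arguments so that the probability structure
    can be inferred from the term. *)
Definition discrete_law of (forall i, (0 <= w i)%R) & (\sum_i w i = 1)%R :=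
  fun B : set T => \sum_i (w i)%:E * \d_(x i) B.

Let mu := discrete_law w0 w1.

Let mu0 : mu set0 = 0.
Proof. by rewrite /mu /discrete_law big1// => i _; rewrite measure0 mule0. Qed.

Let mu_ge0 B : 0 <= mu B.
Proof. by apply: sume_ge0 => i _; rewrite mule_ge0// lee_fin. Qed.

Let mu_sigma_additive : semi_sigma_additive mu.
Proof.
move=> F mF tF mUF; rewrite [X in X @ _ --> _](_ : _ = (fun m =>
    \sum_i \sum_(0 <= k < m) (w i)%:E * \d_(x i) (F k))).
  apply: cvg_nnesum => i _.
    by apply: nearW => m; apply: sume_ge0 => k _; rewrite mule_ge0// lee_fin.
  under eq_fun do rewrite -ge0_sume_distrr//.
  by apply: cvgeZl => //; exact: measure_semi_sigma_additive.
by apply/funext => m; rewrite exchange_big.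
Qed.

HB.instance Definition _ := isMeasure.Build _ _ _ (discrete_law w0 w1)
  mu0 mu_ge0 mu_sigma_additive.

Let mu_setT : mu setT = 1.
Proof.
rewrite /mu /discrete_law; under eq_bigr do rewrite diracT mule1.
by rewrite sumEFin w1.
Qed.

HB.instance Definition _ := Measure_isProbability.Build _ _ _
  (discrete_law w0 w1) mu_setT.

End discrete_law.

(** * Worst-case probability over a Wasserstein ball *)

Lemma big_prod_bool (V : Type) (idx : V) (op : Monoid.com_law idx)
    (I : finType) (F : I * bool -> V) :
  \big[op/idx]_k F k = \big[op/idx]_i op (F (i, true)) (F (i, false)).
Proof.
rewrite (eq_bigr (fun k => F (k.1, k.2))); last by case.
rewrite -(pair_bigA _ (fun i b => F (i, b)))/=.
by apply: eq_bigr => i _; rewrite big_bool.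
Qed.

Section worst_case.
Context {R : realType} {n N : nat}.
Notation T := (borelCV R n).
Variables (nrm : 'cV[R]_n -> R) (hnrm : is_norm nrm).
Variables (xi : 'I_N -> 'cV[R]_n) (hN : (0 < N)%N).
Variables (theta eps : R) (heps : 0 < eps < 1).

(** Move the fraction [al i] of the atom [xi i] to [y i]. The coupling that
    realizes this plan has cost [N^-1 * \sum_i al i * nrm (xi i - y i)]. *)
Lemma perturbed_law (al : 'I_N -> R) (y : 'I_N -> 'cV[R]_n) :
  (forall i, 0 <= al i <= 1) ->
  \sum_i al i * nrm (xi i - y i) <= N%:R * theta ->
  exists2 Q : probability T R, ambiguity nrm xi theta Q &
    forall B, Q B = (N%:R^-1%:E * \sum_i ((al i)%:E * \d_(y i : T) B
                                + (1 - al i)%:E * \d_(xi i : T) B))%E.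
Proof.
move=> al01 cost.
have N0 : 0 < N%:R :> R by rewrite ltr0n.
have al0 i : 0 <= al i by case/andP: (al01 i).
have al1 i : 0 <= 1 - al i by rewrite subr_ge0; case/andP: (al01 i).
(* The flag of an atom tells whether the mass moves. *)
pose w (k : 'I_N * bool) := N%:R^-1 * (if k.2 then al k.1 else 1 - al k.1).
pose x (k : 'I_N * bool) : T * T := (xi k.1, if k.2 then y k.1 else xi k.1).
have w0 k : 0 <= w k by rewrite mulr_ge0 ?invr_ge0// fun_if; case: ifP.
have w1 : \sum_k w k = 1.
  rewrite big_prod_bool.
  under eq_bigr do rewrite /w /= -mulrDr addrC subrK mulr1.
  by rewrite sumr_const card_ord -[_ *+ N]mulr_natl mulfV// gt_eqF.
pose Pi : probability (T * T)%type R := discrete_law x w0 w1.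
pose Q : probability T R := discrete_law (snd \o x) w0 w1.
have QE B : Q B = (N%:R^-1%:E * \sum_i ((al i)%:E * \d_(y i : T) B
                                + (1 - al i)%:E * \d_(xi i : T) B))%E.
  rewrite /Q /= /discrete_law big_prod_bool ge0_sume_distrr; last first.
    by move=> i _; rewrite adde_ge0// mule_ge0// lee_fin.
  apply: eq_bigr => i _; rewrite /w /=.
  rewrite ge0_muleDr ?mule_ge0 ?lee_fin//.
  by rewrite !EFinM !muleA.
exists Q => //.
rewrite /ambiguity /=; apply: (@le_trans _ _
    (\int[Pi]_w (nrm ((w.1 : 'cV[R]_n) - w.2))%:E)%E).
  apply: ereal_inf_lbound; exists Pi => // B mB; split.
    rewrite /pushforward /= /discrete_law /empirical big_prod_bool ge0_sume_distrr//.
    apply: eq_bigr => i _; rewrite /w /= -ge0_muleDl ?lee_fin ?mulr_ge0 ?invr_ge0 ?ler0n//.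
    by rewrite -EFinD -mulrDr addrC subrK mulr1.
  by [].
apply: le_trans (le_integral_discrete (x := x) w0 _ _) _.
- by move=> k; rewrite lee_fin nrm_ge0.
- by [].
rewrite big_prod_bool; under eq_bigr => i _.
  rewrite /w /x /= subrr (nrm0 hnrm) mule0 adde0 -EFinM -mulrA; over.
rewrite sumEFin lee_fin -mulr_sumr mulrC ler_pdivrMr//.
by rewrite [leRHS]mulrC.
Qed.

(** If no dual multiplier [t] existed, knapsack duality would give fractions
    [al i] of total more than [eps * N] whose transport to [U] costs strictly
    less than [N * theta]; the corresponding perturbed law is in the ball and
    gives [U] a mass above [eps]. The distance to [U] need not be attained, so
    the slack [e] in the budget pays for approximate projections. *)
Lemma dual_of_worst_case (delta : 'cV[R]_n -> R) (U : set T) :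
  measurable U -> (forall u, 0 <= delta u) ->
  (forall u e, 0 < e -> exists2 v, U v & nrm (u - v) <= delta u + e) ->
  (forall Q, ambiguity nrm xi theta Q -> (Q U <= eps%:E)%E) ->
  exists2 t, 0 <= t &
    theta + N%:R^-1 * \sum_i Num.max 0 (t - delta (xi i)) <= eps * t.
Proof.
move=> mU delta0 near_U QU.
have N0 : 0 < N%:R :> R by rewrite ltr0n.
have /andP[e0 e1] := heps.
have := @knapsack_duality R N (fun i => delta (xi i)) (eps * N%:R) _ _
  (N%:R * theta) _.
case.
- by rewrite mulr_ge0// ltW.
- by rewrite -[ltRHS]mul1r ltr_pM2r.
- by [].
- move=> [t t0 ht]; exists t => //.
  rewrite -(ler_pM2l N0) mulrDr mulrA mulfV ?gt_eqF// mul1r.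
  by rewrite mulrA (mulrC N%:R eps).
move=> [al [al01 cost gain]]; exfalso.
pose e := (N%:R * theta - \sum_i al i * delta (xi i)) / N%:R.
have ep : 0 < e by rewrite divr_gt0// subr_gt0.
have {near_U} /choice[y hy] : forall i, exists v, U v /\ nrm (xi i - v) <= delta (xi i) + e.
  by move=> i; have [v] := near_U (xi i) e ep; exists v.
have [|Q /QU Qle QE] := @perturbed_law al y al01.
  apply: (@le_trans _ _ (\sum_i (al i * delta (xi i) + e))).
    apply: ler_sum => i _; have /andP[a0 a1] := al01 i.
    rewrite (le_trans (ler_wpM2l a0 (hy i).2))// mulrDr lerD2l.
    by rewrite -[leRHS]mul1r ler_wpM2r// ltW.
  by rewrite big_split/= sumr_const card_ord /e -[_ *+ N]mulr_natr divfK ?gt_eqF// addrC subrK.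
have : (eps%:E < Q U)%E.
  rewrite QE; apply: (@lt_le_trans _ _ (N%:R^-1 * \sum_i al i)%:E).
    by rewrite lte_fin mulrC ltr_pdivlMr.
  rewrite EFinM -sumEFin lee_wpmul2l ?lee_fin ?invr_ge0//.
  apply: lee_sum => i _; rewrite (_ : \d_(y i) U = 1%E); last first.
    by rewrite diracE (mem_set (hy i).1).
  have /andP[a0 a1] := al01 i.
  rewrite mule1 leeDl// mule_ge0// lee_fin subr_ge0//.
by rewrite ltNge Qle.
Qed.

(** Pointwise, [t * \1_U v <= max 0 (t - delta u) + nrm (u - v)]: if [v] is in
    [U] then [delta u <= nrm (u - v)]. Integrating against a coupling of the
    empirical law and [Q] bounds [t * Q U] by
    [N^-1 * \sum_i max 0 (t - delta (xi i))] plus the transport cost. *)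
Lemma weak_duality (delta : T -> R) (U : set T) (t : R) : 0 < theta ->
  measurable U -> measurable_fun setT delta ->
  (forall u v : 'cV[R]_n, U v -> delta u <= nrm (u - v)) ->
  0 <= t -> theta + N%:R^-1 * \sum_i Num.max 0 (t - delta (xi i)) <= eps * t ->
  forall Q, ambiguity nrm xi theta Q -> (Q U <= eps%:E)%E.
Proof.
move=> htheta mU mdelta hU t0 ht Q hQ.
have N0 : 0 < N%:R :> R by rewrite ltr0n.
have /andP[e0 e1] := heps.
pose g (u : T) : R := Num.max 0 (t - delta u).
(* A measurable minorant of the transport cost that suffices for the
   pointwise bound. *)
pose f (uv : T * T) : R := Num.max 0 (t * \1_U uv.2 - g uv.1).
have g0 u : 0 <= g u by rewrite le_max lexx.
have f0 u : 0 <= f u by rewrite le_max lexx.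
have mg : measurable_fun setT g.
  by apply: measurable_maxr => //; exact: measurable_funB.
have mtU : measurable_fun setT (fun uv : T * T => t * \1_U uv.2).
  apply: measurable_funM => //.
  have m1 : measurable_fun setT (\1_U : T -> R) by exact: measurable_indic.
  exact: (measurableT_comp m1 measurable_snd).
have mgf : measurable_fun setT (fun uv : T * T => g uv.1).
  exact: (measurableT_comp mg measurable_fst).
have mf : measurable_fun setT f.
  by apply: measurable_maxr => //; exact: measurable_funB.
have gE : N%:R^-1 * \sum_i Num.max 0 (t - delta (xi i)) =
          N%:R^-1 * \sum_i g (xi i) by [].
set G := N%:R^-1 * _ in ht gE.
have f_le u v : f (u, v) <= nrm ((u : 'cV[R]_n) - v).
  rewrite /f /= ge_max (nrm_ge0 hnrm) /= indicE.
  have [/set_mem/(hU u) uv|_] := boolP (v \in U).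
    rewrite mulr1 lerBlDr -lerBlDl le_max; apply/orP; right.
    by rewrite lerD2l lerN2.
  by rewrite mulr0 sub0r lerNl (le_trans _ (g0 u))// oppr_le0 nrm_ge0.
suff : (t%:E * Q U <= (G + theta)%:E)%E.
  have t1 : 0 < t.
    rewrite -(pmulr_rgt0 _ e0); apply: lt_le_trans ht.
    by rewrite ltr_wpDr// mulr_ge0 ?invr_ge0 ?sumr_ge0// => i _; exact: g0.
  have QU : Q U \is a fin_num by exact: fin_num_measure.
  move=> h; rewrite -(lee_pmul2l _ _ (x := t%:E)) ?lte_fin//.
  by rewrite (le_trans h)// -EFinM lee_fin mulrC addrC.
rewrite EFinD -leeBlDl//.
apply: le_trans hQ; apply: le_ereal_inf_tmp => _ [Pi hPi <-].
rewrite leeBlDl//.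
have -> : (t%:E * Q U = \int[Pi]_w (t * \1_U w.2)%:E)%E.
  have mU2 : measurable (snd @^-1` U : set (T * T)).
    by rewrite -[X in measurable X]setTI; exact: measurable_snd.
  under eq_integral do rewrite EFinM.
  rewrite ge0_integralZl//.
  - by rewrite (integral_indic _ measurableT mU2) setIT -(hPi U mU).2.
  - by apply/measurable_EFinP; exact: (measurable_indic mU2).
apply: (@le_trans _ _ (\int[Pi]_w ((g w.1)%:E + (f w)%:E))%E).
  apply: ge0_le_integral => //.
  - by move=> w _; rewrite lee_fin mulr_ge0.
  - exact/measurable_EFinP.
  - by apply: emeasurable_funD; exact/measurable_EFinP.
  - move=> w _; rewrite -EFinD lee_fin -lerBlDl /f.
    by rewrite le_max lexx orbT.
rewrite ge0_integralD//; last 4 first.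
- by move=> w _; rewrite lee_fin.
- exact/measurable_EFinP.
- by move=> w _; rewrite lee_fin.
- exact/measurable_EFinP.
apply: leeD; last first.
  by apply: ge0_le_integralT => -[u v]; rewrite lee_fin.
have := @ge0_integral_pushforward _ _ _ _ R fst measurable_fst Pi setT (EFin \o g).
rewrite preimage_setT => <-//; last 2 first.
- exact/measurable_EFinP.
- by move=> u _; rewrite lee_fin.
rewrite (eq_measure_integral (empirical xi)); last first.
  by move=> B mB _; case: (hPi B mB).
apply: (@le_trans _ _ (\sum_i N%:R^-1%:E * (g (xi i))%:E)%E).
  apply: (@le_integral_discrete _ T R (empirical xi) _ _ xi (EFin \o g)).
  - by move=> i; rewrite invr_ge0.
  - by move=> y; rewrite lee_fin.
  - by move=> B mB; rewrite /= /empirical ge0_sume_distrr.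
by rewrite -ge0_sume_distrr ?sumEFin// => i _; rewrite lee_fin.
Qed.

End worst_case.

(** * Distance to the unsafe set *)

Lemma borelCV_measurable_open (R : realType) n (U : set 'cV[R]_n) :
  open U -> measurable (U : set (borelCV R n)).
Proof. by move=> oU; exact: sub_sigma_algebra. Qed.

Lemma measurable_coordCV (R : realType) n (k : 'I_n) :
  measurable_fun setT (fun u : borelCV R n => (u : 'cV[R]_n) k 0).
Proof.
apply: (measurability _ (RGenOpens.measurableE R)).
move=> _ [_ [r [s ->]] <-]; rewrite setTI.
have /continuousP ck := @coord_continuous R n 1 k 0.
by apply: borelCV_measurable_open; apply: (ck `]r, s[%classic); apply: interval_open.
Qed.

Lemma measurable_dot_block (R : realType) P K0 (v : 'cV[R]_K0) (p : 'I_P) :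
  measurable_fun setT (fun u : borelCV R (P * K0) => dot v (block u p)).
Proof.
apply: measurable_sum => k; under eq_fun do rewrite mxE.
by apply: measurable_funM => //; exact: measurable_coordCV.
Qed.

Lemma measurable_bigmin d (T : measurableType d) (R : realType) (I : Type)
    (s : seq I) (f0 : T -> R) (f : I -> T -> R) :
  measurable_fun setT f0 -> (forall i, measurable_fun setT (f i)) ->
  measurable_fun setT (fun u => \big[Num.min/f0 u]_(i <- s) f i u).
Proof.
move=> mf0 mf; elim: s => [|i s ih]; first by under eq_fun do rewrite big_nil.
by under eq_fun do rewrite big_cons; exact: measurable_minr.
Qed.

Lemma X_DRP (R : realType) n L (nrm : 'cV[R]_n -> R) N (xi : 'I_N -> 'cV[R]_n)
    (theta eps : R) (X : set 'cV[R]_L) (S : 'cV[R]_L -> set 'cV[R]_n) x :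
  X_DR nrm xi theta eps X S x <->
  X x /\ forall Q, ambiguity nrm xi theta Q -> (Q (~` S x) <= eps%:E)%E.
Proof.
split=> -[Xx h]; split => //.
  by move=> Q hQ; apply: le_trans h; apply: ereal_sup_ubound; exists Q.
by apply: ge_ereal_sup => _ [Q hQ <-]; exact: h.
Qed.

Section model.
Context {R : realType} {L N P K0 : nat}.
Variables (p0 : 'I_P).
Variables (A : 'M[R]_(L, K0)) (b : 'cV[R]_K0).
Variables (a : 'I_P -> 'cV[R]_L) (d : 'I_P -> R).
Variable x : 'cV[R]_L.
Let w := b - A^T *m x.
Local Notation T := (borelCV R (P * K0)).
Local Notation slk := (slack A b a d x).

Lemma slackE u p : slk u p = dot w (block u p) + d p - dot (a p) x.
Proof.
by rewrite /slack /w !dotDl !dotNl dot_trmx; ring.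
Qed.

Lemma S_openE u : S_open A b a d x u <-> forall p, 0 < slk u p.
Proof. by split=> h p; move: (h p); rewrite slackE. Qed.

Lemma S_closedE u : S_closed A b a d x u <-> forall p, 0 <= slk u p.
Proof. by split=> h p; move: (h p); rewrite slackE. Qed.

Lemma slackB u v p : slk u p - slk v p = dot (place p w) (u - v).
Proof. by rewrite !slackE dotBr !dot_place; ring. Qed.

(** Taking the slack of some constraint [p0] as the default value makes this
    the minimum over the constraints only. *)
Definition min_slack (u : 'cV[R]_(P * K0)) : R :=
  \big[Num.min/slk u p0]_p slk u p.

Lemma min_slack_le u p : min_slack u <= slk u p.
Proof. exact: bigmin_le. Qed.

Lemma min_slackP u c : c <= min_slack u <-> forall p, c <= slk u p.
Proof.
split=> [h p|h]; first exact: le_trans (min_slack_le u p).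
by apply: le_bigmin => // p _.
Qed.

Lemma min_slack_attained u : exists p, slk u p = min_slack u.
Proof.
exists [arg min_(p < p0) slk u p]%O; case: arg_minP => // p _ hp.
apply/eqP; rewrite eq_le min_slack_le andbT.
by apply/min_slackP => q; exact: hp.
Qed.

Lemma measurable_min_slack : measurable_fun setT (min_slack : T -> R).
Proof.
have mslk p : measurable_fun setT (slk^~ p : T -> R).
  under eq_fun do rewrite slackE.
  apply: measurable_funB => //; apply: measurable_funD => //.
  exact: measurable_dot_block.
exact: measurable_bigmin.
Qed.

Lemma S_open_min_slack : S_open A b a d x = [set u | 0 < min_slack u].
Proof.
apply/seteqP; split=> u /=.
  by have [p <-] := min_slack_attained u => /S_openE.
move=> h; apply/S_openE => p; exact: lt_le_trans (min_slack_le u p).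
Qed.

Lemma S_closed_min_slack : S_closed A b a d x = [set u | 0 <= min_slack u].
Proof.
by apply/seteqP; split=> u /=; rewrite S_closedE => /min_slackP.
Qed.

Lemma measurable_unsafe_open : measurable (~` S_open A b a d x : set T).
Proof.
apply: measurableC; rewrite S_open_min_slack -[X in measurable X]setTI.
have -> : [set u | 0 < min_slack u] = min_slack @^-1` `]0, +oo[%classic.
  by rewrite preimage_itvoy.
by apply: measurable_min_slack => //; exact: measurable_itv.
Qed.

Lemma measurable_unsafe_closed : measurable (~` S_closed A b a d x : set T).
Proof.
apply: measurableC; rewrite S_closed_min_slack -[X in measurable X]setTI.
have -> : [set u | 0 <= min_slack u] = min_slack @^-1` `[0, +oo[%classic.
  by rewrite preimage_itvcy.
by apply: measurable_min_slack => //; exact: measurable_itv.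
Qed.

Variable nrm : 'cV[R]_(P * K0) -> R.
Hypothesis hnrm : is_norm nrm.
Variable nu : R.
Hypothesis nuE : forall p, nu = dual_norm nrm (place p w).
Hypothesis nu_gt0 : 0 < nu.

(** The half-space where one constraint fails has normal vector [place p w], so
    its distance is the positive part of the slack divided by the dual norm
    [nu] of that vector; the unsafe set is the union of these half-spaces. *)
Definition unsafe_dist (u : 'cV[R]_(P * K0)) : R := Num.max 0 (min_slack u) / nu.

Lemma unsafe_dist_ge0 u : 0 <= unsafe_dist u.
Proof. by rewrite divr_ge0 ?(ltW nu_gt0)// le_max lexx. Qed.

Lemma measurable_unsafe_dist : measurable_fun setT (unsafe_dist : T -> R).
Proof.
apply: measurable_funM => //.
by apply: measurable_maxr => //; exact: measurable_min_slack.
Qed.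

(** Moving from [u] to [v] changes a slack by at most [nu * nrm (u - v)]; a
    constraint violated at [v] has lost all the slack it had at [u]. *)
Lemma unsafe_dist_le u v : ~ S_open A b a d x v -> unsafe_dist u <= nrm (u - v).
Proof.
rewrite S_openE => /existsNP[p /negP]; rewrite -leNgt => vp.
have bound0 : 0 <= nrm (u - v) * nu by rewrite mulr_ge0 ?(nrm_ge0 hnrm)// ltW.
rewrite ler_pdivrMr// ge_max bound0 /= mulrC (nuE p).
apply: le_trans (dot_le_dual_norm hnrm _ _).
by rewrite -slackB; have := min_slack_le u p; lra.
Qed.

(** Move against an almost optimal direction of the dual norm for the tightest
    constraint. The extra step [e] makes up for the supremum not being known to
    be attained, and makes the constraint strictly negative, so that even the
    closed safety set is left. *)
Lemma unsafe_dist_approx u e : 0 < e ->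
  exists2 v, (~` S_closed A b a d x) v & nrm (u - v) <= unsafe_dist u + e.
Proof.
move=> e0; have [p hp] := min_slack_attained u.
set lam := unsafe_dist u + e.
have lam0 : 0 < lam by rewrite ltr_wpDl// unsafe_dist_ge0.
have : Num.max 0 (min_slack u) / lam < nu.
  rewrite ltr_pdivrMr// -ltr_pdivrMl// mulrC.
  by rewrite /lam /unsafe_dist ltrDl.
rewrite (nuE p) => /(dual_norm_adherent hnrm)[h h1].
rewrite ltr_pdivrMr// gt_max => /andP[_ hlam].
exists (u - lam *: h).
  rewrite /= S_closedE => /(_ p); apply/negP; rewrite -ltNge.
  have := slackB u (u - lam *: h) p.
  by rewrite subKr dotZr hp; lra.
rewrite subKr; case: (hnrm) => _ -> _.
by rewrite gtr0_norm// -[leRHS]mulr1 ler_pM2l.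
Qed.

End model.

(** * The mixed-integer program as the transport dual *)

Section mip.
Context {R : realType} {L N P K0 : nat}.
Variables (hN : (0 < N)%N) (p0 : 'I_P).
Variables (A : 'M[R]_(L, K0)) (b : 'cV[R]_K0).
Variables (a : 'I_P -> 'cV[R]_L) (d : 'I_P -> R).
Variables (X : set 'cV[R]_L) (eps theta : R) (xi : 'I_N -> 'cV[R]_(P * K0)).
Hypotheses (heps : 0 < eps < 1) (htheta : 0 < theta).
Variables (dnorm : 'cV[R]_K0 -> R) (M : 'I_N -> R) (x : 'cV[R]_L).
Hypothesis hM : forall i p, `|slack A b a d x (xi i) p| <= M i.
Hypothesis Xx : X x.
Local Notation slk := (slack A b a d x).
Local Notation nu := (dnorm (b - A^T *m x)).
Local Notation mslk := (min_slack p0 A b a d x).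
Local Notation mdist := (unsafe_dist p0 A b a d x nu).
Local Notation Fplus := (F_plus A b a d X dnorm xi M theta eps).
Local Notation Fbase := (F_base A b a d X dnorm xi M theta eps).

Lemma F_plus_sub_F_base : Fplus x -> Fbase x.
Proof. by move=> [_ [z [t [r [h _]]]]]; split => //; exists z, t, r. Qed.

(** The big-M constraints encode [t - r i <= max 0 (min_slack (xi i))], with
    [z i] selecting one of the two arguments of the maximum. *)
Lemma mip_base_margin z t r i :
  mip_base A b a d dnorm xi M theta eps x z t r ->
  t - r i <= Num.max 0 (mslk (xi i)).
Proof.
move=> [_ _ h2 h3]; rewrite le_max; case zi: (z i).
  by have := h2 i; rewrite zi subrr mulr0 => ->.
apply/orP; right; apply/min_slackP => p.
by have := h3 i p; rewrite zi mulr0 addr0.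
Qed.

Let N0 : 0 < N%:R :> R. Proof. by rewrite ltr0n. Qed.

Section nondegenerate.
Hypothesis nu_gt0 : 0 < nu.

(** The transport multiplier is [t / nu], since margins are distances scaled by
    [nu]; [r i / nu] then dominates the excess of sample [i]. *)
Lemma F_base_dual : Fbase x -> exists2 t, 0 <= t &
  theta + N%:R^-1 * \sum_i Num.max 0 (t - mdist (xi i)) <= eps * t.
Proof.
move=> [_ [z [t [r h]]]]; have [[t0 r0] h1 _ _] := h.
exists (t / nu); first by rewrite divr_ge0// ltW.
rewrite mulrA ler_pdivlMr// mulrDl; apply: le_trans h1.
rewrite lerD2l -mulrA ler_wpM2l ?invr_ge0 ?ler0n// mulr_suml.
apply: ler_sum => i _; rewrite -ler_pdivlMr// ge_max.
rewrite divr_ge0 ?r0 ?(ltW nu_gt0)//= -mulrBl ler_wpM2r ?invr_ge0 ?(ltW nu_gt0)//.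
by rewrite lerBlDr addrC -lerBlDr (mip_base_margin _ h).
Qed.

(** The canonical choice, [z i] flagging exactly the samples that are violated,
    satisfies the cuts for free: a violated sample has [r i >= nu * t > 0], and
    the budget constraint bounds the sum of the [r i] by [N * eps * nu * t], so
    there are at most [eps * N] of them. *)
Lemma dual_F_plus t : 0 <= t ->
  theta + N%:R^-1 * \sum_i Num.max 0 (t - mdist (xi i)) <= eps * t ->
  Fplus x.
Proof.
move=> t0 ht; split => //.
pose z i := mslk (xi i) < 0.
pose r i := Num.max 0 (nu * t - Num.max 0 (mslk (xi i))).
have rE i : r i = nu * Num.max 0 (t - mdist (xi i)).
  rewrite maxr_pMr ?(ltW nu_gt0)// mulr0 mulrBr /unsafe_dist.
  by rewrite [nu * (_ / _)]mulrC divfK// gt_eqF.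
have e0 : 0 < eps by case/andP: heps.
have r0 i : 0 <= r i by rewrite le_max lexx.
have margin i : nu * t - r i <= Num.max 0 (mslk (xi i)).
  by rewrite lerBlDl -lerBlDr le_max lexx orbT.
have unsafe i p : 0 <= slk (xi i) p + M i.
  by have := hM i p; rewrite ler_norml => /andP[+ _]; rewrite -subr_ge0 opprK.
have budget : theta * nu + N%:R^-1 * \sum_i r i <= eps * (nu * t).
  under eq_bigr do rewrite rE.
  rewrite -mulr_sumr mulrCA [eps * _]mulrCA (mulrC theta) -mulrDr.
  by rewrite ler_pM2l.
exists z, (nu * t), r; split; split => //.
- by split => //; rewrite mulr_ge0// ltW.
- move=> i; rewrite /z; case: ltP => zi.
    by rewrite subrr mulr0 (le_trans (margin i))// max_l// ltW.
  rewrite subr0 mulr1 (le_trans (margin i))// max_r//.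
  rewrite (le_trans (min_slack_le _ _ _ _ _ _ _ p0))//.
  by rewrite (le_trans (ler_norm _)).
- move=> i p; rewrite /z; case: ltP => zi; rewrite ?mulr1 ?mulr0 ?addr0.
    by apply: le_trans (unsafe i p); rewrite (le_trans (margin i))// max_l// ltW.
  by rewrite (le_trans (margin i))// max_r// min_slack_le.
- rewrite floor_ge_int.
  have t1 : 0 < t.
    rewrite -(pmulr_rgt0 _ e0); apply: lt_le_trans ht.
    rewrite ltr_wpDr// mulr_ge0 ?invr_ge0 ?sumr_ge0// => i _.
    by rewrite le_max lexx.
  have nt : 0 < nu * t by rewrite mulr_gt0.
  rewrite -(ler_pM2r nt) -pmulrn natr_sum mulr_suml.
  apply: (@le_trans _ _ (\sum_i r i)).
    apply: ler_sum => i _; rewrite /z /r; case: ltP => zi; rewrite ?mul1r ?mul0r.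
      by rewrite subr0 le_max lexx orbT.
    by rewrite le_max lexx.
  rewrite -(ler_pM2l (_ : 0 < N%:R^-1)) ?invr_gt0//.
  rewrite [leRHS](_ : _ = eps * (nu * t)); last first.
    by rewrite mulrC -!mulrA [eps * _]mulrC; field; rewrite gt_eqF.
  by apply: le_trans budget; rewrite ler_wpDl// mulr_ge0// ltW.
- move=> i p; rewrite /z; case: ltP => zi; rewrite ?mulr1 ?mulr0 ?addr0//.
  exact: le_trans zi (min_slack_le _ _ _ _ _ _ _ _).
Qed.

End nondegenerate.
End mip.

(** * The feasible sets, point by point *)

Section pointwise.
Context {R : realType} {L N P K0 : nat}.
Variables (hN : (0 < N)%N) (p0 : 'I_P).
Variables (X : set 'cV[R]_L).
Variables (A : 'M[R]_(L, K0)) (b : 'cV[R]_K0).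
Variables (a : 'I_P -> 'cV[R]_L) (d : 'I_P -> R).
Variables (eps theta : R) (heps : 0 < eps < 1) (htheta : 0 < theta).
Variables (xi : 'I_N -> 'cV[R]_(P * K0)).
Variables (nrm : 'cV[R]_(P * K0) -> R) (hnrm : is_norm nrm).
Variable (dnorm : 'cV[R]_K0 -> R).
Hypothesis hdnorm : forall (p : 'I_P) (v : 'cV[R]_K0),
     dnorm v = dual_norm nrm (place p v).
Variable (M : 'I_N -> R).
Hypothesis hM0 : forall i, 0 < M i.
Hypothesis hM : forall i x p, X x -> `|slack A b a d x (xi i) p| <= M i.
Local Notation Fplus := (F_plus A b a d X dnorm xi M theta eps).
Local Notation Fbase := (F_base A b a d X dnorm xi M theta eps).
Local Notation DRo := (X_DR nrm xi theta eps X (S_open A b a d)).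
Local Notation DRc := (X_DR nrm xi theta eps X (S_closed A b a d)).

Lemma S_open_sub_closed x : S_open A b a d x `<=` S_closed A b a d x.
Proof. by move=> u h p; rewrite ltW. Qed.

Lemma DRo_sub_DRc x : DRo x -> DRc x.
Proof.
move=> /X_DRP[Xx h]; apply/X_DRP; split=> // Q hQ; apply: le_trans (h _ hQ).
apply: le_measure; rewrite ?inE.
- exact: (measurable_unsafe_closed p0).
- exact: (measurable_unsafe_open p0).
- exact/subsetC/S_open_sub_closed.
Qed.

(** A cycle of implications: [Fplus] into [Fbase] into [DRo] into [DRc] into
    [Fplus]. *)
Lemma nondegenerate_equiv x : X x -> b != A^T *m x ->
  [/\ Fplus x <-> Fbase x, Fplus x <-> DRo x & Fplus x <-> DRc x].
Proof.
move=> Xx bx.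
have nu0 : 0 < dnorm (b - A^T *m x).
  rewrite (hdnorm p0) (dual_norm_gt0 hnrm)//.
  by apply: place_neq0; rewrite subr_eq0.
have hMx i p := hM i p Xx.
set mdist := unsafe_dist p0 A b a d x (dnorm (b - A^T *m x)).
have nuE p := hdnorm p (b - A^T *m x).
have PB : Fplus x -> Fbase x by exact: F_plus_sub_F_base.
have BD : Fbase x -> DRo x.
  move=> /(F_base_dual p0 nu0)[t t0 ht].
  apply/X_DRP; split=> // Q; apply: (weak_duality hnrm hN heps htheta _ _ _ t0 ht).
  - exact: (measurable_unsafe_open p0).
  - exact: measurable_unsafe_dist.
  - by move=> u v; exact: unsafe_dist_le.
have oc : DRo x -> DRc x by exact: DRo_sub_DRc.
have cP : DRc x -> Fplus x.
  move=> /X_DRP[_ hQ].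
  have [||||t t0 ht] := @dual_of_worst_case _ _ N nrm hnrm xi hN theta eps heps
    mdist (~` S_closed A b a d x).
  - exact: (measurable_unsafe_closed p0).
  - by move=> u; exact: unsafe_dist_ge0.
  - by move=> u e; exact: unsafe_dist_approx.
  - exact: hQ.
  by apply: (dual_F_plus hN _ _ _ _ _ t0 ht).
by split; split; tauto.
Qed.

Lemma ambiguity_nonempty : ambiguity nrm xi theta !=set0.
Proof.
have [||Q hQ _] := @perturbed_law _ _ N nrm hnrm xi hN theta (fun=> 0) xi.
- by move=> i; rewrite lexx ler01.
- by rewrite big1 ?mulr_ge0 ?ler0n ?ltW// => i _; rewrite mul0r.
by exists Q.
Qed.

Section degenerate.
Variable x : 'cV[R]_L.
Hypotheses (Xx : X x) (bx : b = A^T *m x).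

Lemma slack_degenerate u p : slack A b a d x u p = d p - dot (a p) x.
Proof. by rewrite slackE {1}bx subrr dot0l add0r. Qed.

(** With [t = 0] and no flagged sample the program only asks that the constant
    slacks be nonnegative, in which case no point is unsafe for the closed
    safety set. *)
Lemma degenerate_feasible : (forall p, dot (a p) x <= d p) -> Fplus x /\ DRc x.
Proof.
move=> h; have slk0 u p : 0 <= slack A b a d x u p.
  by rewrite slack_degenerate subr_ge0.
split.
  split=> //; exists (fun=> false), 0, (fun=> 0); split; split => //.
  - rewrite bx subrr (hdnorm p0) /place big1 => [|k _].
      by rewrite (dual_norm0 hnrm) big1// !mulr0 addr0.
    by rewrite mxE scale0r.
  - by move=> i; rewrite !subr0 mulr1 ltW.
  - by move=> i p; rewrite subr0 mulr0 addr0.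
  - rewrite big1// floor_ge_int mulr_ge0 ?ler0n//.
    by case/andP: heps => /ltW.
  - by move=> i p; rewrite mulr0 addr0.
apply/X_DRP; split=> // Q _.
rewrite (_ : ~` _ = set0) ?measure0 ?lee_fin; first by case/andP: heps => /ltW.
by apply/seteqP; split=> // u; apply; apply/S_closedE.
Qed.

Lemma degenerate_DRo : DRo x <-> forall p, dot (a p) x < d p.
Proof.
split=> [/X_DRP[_ h] p|h].
  have [Q hQ] := ambiguity_nonempty.
  rewrite ltNge; apply/negP => dp; have := h Q hQ.
  rewrite (_ : ~` _ = setT) ?probability_setT ?lee_fin; last first.
    apply/seteqP; split=> // u _ /S_openE/(_ p).
    by rewrite slack_degenerate subr_gt0 ltNge dp.
  by case/andP: heps => _; rewrite ltNge => /negP.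
apply/X_DRP; split=> // Q _.
rewrite (_ : ~` _ = set0) ?measure0 ?lee_fin; first by case/andP: heps => /ltW.
apply/seteqP; split=> // u; apply; apply/S_openE => p.
by rewrite slack_degenerate subr_gt0.
Qed.

(** Every point is unsafe, so each law in the ball has unsafe mass 1, and every
    sample must be flagged, which the cardinality cut forbids. *)
Lemma degenerate_infeasible p : d p < dot (a p) x -> ~ Fplus x /\ ~ DRc x.
Proof.
move=> dp; have slk0 u : slack A b a d x u p < 0.
  by rewrite slack_degenerate subr_lt0.
split.
  move=> [_ [z [t [r [_ [hz h5]]]]]].
  have zT i : z i by have := h5 i p; case: (z i) => //; rewrite mulr0 addr0 leNgt slk0.
  move: hz; rewrite (eq_bigr (fun=> 1%N)) => [|i _]; last by rewrite zT.
  rewrite sum_nat_const card_ord muln1 floor_ge_int -pmulrn leNgt.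
  by rewrite -[ltRHS]mul1r ltr_pM2r ?ltr0n//; case/andP: heps => _ ->.
move=> /X_DRP[_ h].
have [Q hQ] := ambiguity_nonempty; have := h Q hQ.
rewrite (_ : ~` _ = setT) ?probability_setT ?lee_fin; last first.
  by apply/seteqP; split=> // u _ /S_closedE/(_ p); rewrite leNgt slk0.
by case/andP: heps => _; rewrite ltNge => /negP.
Qed.

End degenerate.
End pointwise.

Theorem theorem1 (R : realType) (L N P K0 : nat)
  (hN : (0 < N)%N) (hP : (0 < P)%N) (hK0 : (0 < K0)%N)
  (X : set 'cV[R]_L)
  (A : 'M[R]_(L, K0)) (b : 'cV[R]_K0) (a : 'I_P -> 'cV[R]_L) (d : 'I_P -> R)
  (eps theta : R) (heps : 0 < eps < 1) (htheta : 0 < theta)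
  (xi : 'I_N -> 'cV[R]_(P * K0))
  (nrm : 'cV[R]_(P * K0) -> R) (hnrm : is_norm nrm)
  (dnorm : 'cV[R]_K0 -> R)
  (hdnorm : forall (p : 'I_P) (v : 'cV[R]_K0),
     dnorm v = dual_norm nrm (place p v))
  (M : 'I_N -> R) (hM0 : forall i, 0 < M i)
  (hM : forall i x p, X x -> `|slack A b a d x (xi i) p| <= M i) :
  [/\ F_plus A b a d X dnorm xi M theta eps =
        F_base A b a d X dnorm xi M theta eps `\` degenerate_lt A b a d X,
      F_plus A b a d X dnorm xi M theta eps =
        X_DR nrm xi theta eps X (S_open A b a d)
          `|` (degenerate_eq A b a d X `\` degenerate_lt A b a d X)
    & F_plus A b a d X dnorm xi M theta eps =
        X_DR nrm xi theta eps X (S_closed A b a d)].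
Proof.
have p0 : 'I_P := Ordinal hP.
pose lt := degenerate_lt A b a d X; pose eq := degenerate_eq A b a d X.
set Fp := F_plus _ _ _ _ _ _ _ _ _ _; set Fb := F_base _ _ _ _ _ _ _ _ _ _.
set Do := X_DR _ _ _ _ _ (S_open A b a d); set Dc := X_DR _ _ _ _ _ _.
have main x : X x -> [/\ Fp x <-> Fb x /\ ~ lt x,
    Fp x <-> Do x \/ (eq x /\ ~ lt x) & Fp x <-> Dc x].
  move=> Xx; have [bx|bx] := eqVneq b (A^T *m x); last first.
    have [h1 h2 h3] := nondegenerate_equiv hN p0 heps htheta hnrm hdnorm hM Xx bx.
    have nlt : ~ lt x by move=> [_ /eqP]; rewrite (negbTE bx).
    have neq : ~ eq x by move=> [_ /eqP]; rewrite (negbTE bx).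
    by split; tauto.
  have [lex|/existsNP[p /negP]] := pselect (forall p, dot (a p) x <= d p).
    have [Fx Dx] : Fp x /\ Dc x by exact: degenerate_feasible.
    have nlt : ~ lt x by move=> [_ _ [p]]; rewrite ltNge lex.
    have Fbx : Fb x by exact: F_plus_sub_F_base.
    split; [tauto| |tauto].
    split=> // _.
    have [ltx|/existsNP[p /negP]] := pselect (forall p, dot (a p) x < d p).
      by left; apply/degenerate_DRo.
    rewrite -leNgt => dp; right; split=> //; split=> //; exists p.
    by apply/eqP; rewrite eq_le dp lex.
  rewrite -ltNge => dp.
  have [nF nD] : ~ Fp x /\ ~ Dc x by apply: degenerate_infeasible dp.
  have ltx : lt x by split=> //; exists p.
  have nDo : ~ Do x.
    by move=> /(DRo_sub_DRc p0).
  by split; tauto.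
split; apply/seteqP; split=> x h.
- by have [m _ _] := main x h.1; exact/m.
- by have [m _ _] := main x h.1.1; exact/m.
- by have [_ m _] := main x h.1; exact/m.
- have Xx : X x by case: h => [[]//|[[]]].
  by have [_ m _] := main x Xx; exact/m.
- by have [_ _ m] := main x h.1; exact/m.
- by have [_ _ m] := main x h.1; exact/m.
Qed.
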